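(* For every $b\in[0,1]$ there exists a monotone $(b,\gamma(b))$-balanced contention resolution scheme for the general matching polytope; that is, for every finite graph $G=(V,E)$ there is a monotone $(b,\gamma(b))$-balanced contention resolution scheme for $P_{\mathcal{M}(G)}$.
   Context: Graphs may have parallel edges (no loops). $\mathcal{M}(G)$ is the family of matchings of $G$ and $P_{\mathcal{M}(G)}=\mathrm{conv}\{\chi^M:M\in\mathcal M(G)\}$ its matching polytope. For $x\in[0,1]^E$, $R(x)$ is a random subset of $E$ containing each $e$ independently with probability $x_e$. A $(b,c)$-balanced CR scheme for $P=P_{\mathcal F}$ is a procedure that for every $x\in bP$ and $A\subseteq\mathrm{supp}(x)$ returns a (possibly random) $\pi_x(A)\subseteq A$ with $\pi_x(A)\in\mathcal F$ such that $\Pr[e\in\pi_x(R(x))]\ge c\,x_e$ for all $e\in\mathrm{supp}(x)$; it is monotone if for all $x\in bP$, $\Pr[e\in\pi_x(A)]\ge\Pr[e\in\pi_x(B)]$ whenever $e\in A\subseteq B\subseteq\mathrm{supp}(x)$. $\gamma(b)=\mathbb{E}\big[\frac{1}{1+X}\big]$ with $X$ Poisson with parameter $2b$; for $b>0$ this equals $\frac{1-e^{-2b}}{2b}$. *)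

(* Defs.v *)
From mathcomp Require Import all_boot all_order all_algebra.
From mathcomp Require Import all_classical all_reals all_analysis.

Set Implicit Arguments.
Unset Strict Implicit.
Unset Printing Implicit Defensive.

Import Order.TTheory GRing.Theory Num.Theory.

Local Open Scope ring_scope.

Record multigraph := Multigraph {
  vertex : finType;
  edge : finType;
  ends : edge -> {set vertex};
  card_ends : forall e, #|ends e| = 2%N }.

Definition matchings (G : multigraph) : {set {set edge G}} :=
  [set M : {set edge G} | [forall e in M, forall f in M,
              (e != f) ==> [disjoint ends e & ends f]]].

Definition convex_hull (R : realType) (V : lmodType R) (A : set V) : set V :=
  smallest (@convex_set R V) A.

Section Polytope.
Variables (R : realType) (E : finType).

Definition char_vec (S : {set E}) : {ffun E -> R^o} :=
  [ffun e => (e \in S)%:R].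

Definition polytope (F : {set {set E}}) : set {ffun E -> R^o} :=
  convex_hull [set char_vec S | S in [set S | S \in F]]%classic.

Definition scaled_polytope (b : R) (F : {set {set E}}) : set {ffun E -> R^o} :=
  [set b *: y | y in polytope F]%classic.

Definition supp (x : {ffun E -> R^o}) : {set E} := [set e | x e != 0].

End Polytope.

Record fdist (R : realType) (T : finType) := FDist {
  fdist_pmf :> {ffun T -> R};
  fdist_ge0 : forall t, 0 <= fdist_pmf t;
  fdist_sum1 : \sum_t fdist_pmf t = 1 }.

Definition Pr (R : realType) (T : finType) (d : fdist R T) (Q : pred T) : R :=
  \sum_(t | Q t) d t.

Section ContentionResolution.
Variables (R : realType) (E : finType).

(* The value of [R(x)] has a product law: its indicator variables are
   independent, the one of [e] being Bernoulli with parameter [x e]. *)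
Definition sample_pmf (x : {ffun E -> R^o}) (A : {set E}) : R :=
  \prod_(e : E) bernoulli_pmf (x e) (e \in A).

(* [pi x A] is the law of the random set returned on input [x] and [A]; it is
   irrelevant unless [x] lies in the scaled polytope and [A] is a subset of
   [supp x]. *)
Definition random_selection :=
  {ffun E -> R^o} -> {set E} -> fdist R {set E}.

(* The internal randomness of [pi] is independent of [R(x)]. *)
Definition selection_prob (pi : random_selection) (x : {ffun E -> R^o}) (e : E)
    : R :=
  \sum_(A : {set E}) sample_pmf x A * Pr (pi x A) (fun S => e \in S).

Definition balanced_cr_scheme (F : {set {set E}}) (b c : R)
    (pi : random_selection) :=
  forall x, scaled_polytope b F x ->
    (forall A : {set E}, A \subset supp x ->
       forall S : {set E}, pi x A S != 0 -> S \subset A /\ S \in F) /\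
    (forall e, e \in supp x -> c * x e <= selection_prob pi x e).

Definition monotone_scheme (F : {set {set E}}) (b : R)
    (pi : random_selection) :=
  forall x, scaled_polytope b F x ->
    forall (e : E) (A B : {set E}),
      e \in A -> A \subset B -> B \subset supp x ->
      Pr (pi x B) (fun S => e \in S) <= Pr (pi x A) (fun S => e \in S).

End ContentionResolution.

(* The last argument of [poisson_prob] is unused by its definition, and at rate 0
   that measure is the Dirac measure at 0. The expectation is finite, the
   variable having values in [0, 1], so [fine] loses nothing. *)
Definition gamma (R : realType) (b : R) : R :=
  fine (expectation (poisson_prob (2 * b) 0)
          (fun k : nat => (1 + k%:R)^-1 : R)).

(* Main.v *)
Require Import Defs.
From mathcomp Require Import all_boot all_order all_algebra.
From mathcomp Require Import all_classical all_reals all_analysis.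
From mathcomp Require Import ring lra.

Set Implicit Arguments.
Unset Strict Implicit.
Unset Printing Implicit Defensive.

Import Order.TTheory GRing.Theory Num.Theory.
Import numFieldNormedType.Exports.

Local Open Scope ring_scope.

(** Let every sampled edge run an exponential-like clock, and select an edge
    when it rings before time 1 and strictly before all the edges touching it.
    The clock of [e] is such that, including the randomness of [e \in R(x)], it
    is the first success of independent trials of probability [x_e / n] at the
    times [1/n, ..., n/n]. More competitors can only hurt, whence monotonicity,
    and by independence [e] is selected with probability at least
    [x_e / n * \sum_(i < n) (1 - l / n) ^ (i + 1)] where [l] is the total
    weight of the edges touching [e]. This Riemann sum converges to
    [x_e * (1 - exp (- l)) / l]. Since [e] is counted at both of its ends,
    [l <= 2 b - x_e < 2 b], so a fixed large [n] already beats
    [gamma b = (1 - exp (- 2 b)) / (2 b)]: no limit of schemes is needed. *)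

(** * Closed form of [gamma] *)

Lemma cvg_series_exp_coeff_shift (R : realType) (r : R) :
  (series (fun k => exp_coeff r k.+1) @ \oo --> expR r - 1)%classic.
Proof.
have -> : series (fun k => exp_coeff r k.+1)
    = (fun n => series (exp_coeff r) n.+1 - 1).
  apply/funext => n; rewrite /series /= big_nat_recl //= /exp_coeff /=.
  by rewrite expr0 fact0 divr1 addrC addKr.
apply: cvgB; last exact: cvg_cst.
rewrite cvg_shiftS; exact: is_cvg_series_exp_coeff.
Qed.

(** At a positive rate the Poisson measure is the series of Dirac masses with weights [poisson_pmf],
    and integrating against a Dirac mass is evaluation. *)
Lemma ge0_integral_poisson (R : realType) (r : R) (i : nat) (f : nat -> \bar R) :
  0 < r -> (forall k, 0 <= f k)%E ->
  (\int[poisson_prob r i]_k f k = \sum_(k <oo) (poisson_pmf r k)%:E * f k)%E.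
Proof.
move=> r0 f0.
pose c k : {nonneg R} := NngNum (poisson_pmf_ge0 r k).
transitivity (\int[mseries (fun k => mscale (c k) (dirac k)) 0]_k f k)%E.
  apply: eq_measure_integral => A _ _.
  rewrite /= /poisson_prob r0 /mseries.
  rewrite [RHS](_ : _ = \sum_(0 <= k <oo | k \in A) (poisson_pmf r k)%:E)%E.
    by rewrite nneseries_esum ?set_mem_set// => k _; rewrite lee_fin poisson_pmf_ge0.
  rewrite [RHS]eseries_mkcond; apply: eq_eseriesr => k _.
  rewrite -[LHS]/((poisson_pmf r k)%:E * \d_k A)%E diracE.
  by case: (k \in A); rewrite ?mule1 ?mule0.
rewrite ge0_integral_measure_series //.
apply: eq_eseriesr => k _.
rewrite ge0_integral_mscale // integral_dirac // diracT mul1e //.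
Qed.

Lemma gammaE (R : realType) (b : R) : 0 < b ->
  gamma b = (1 - expR (- (2 * b))) / (2 * b).
Proof.
move=> b0; set r := 2 * b.
have r0 : 0 < r by rewrite mulr_gt0.
rewrite /gamma -/r unlock ge0_integral_poisson //.
have -> : (\sum_(k <oo) (poisson_pmf r k)%:E * (1 + k%:R)^-1%:E
   = ((expR (- r) / r) * (expR r - 1))%:E)%E.
  apply/cvg_lim => //.
  (* Termwise, [r ^ k / k! / (k + 1) = r ^ (k + 1) / (k + 1)! / r]: the exponential series without
     its constant term. *)
  have E : (fun n => \sum_(0 <= k < n) (poisson_pmf r k)%:E * (1 + k%:R)^-1%:E)%E
     = (EFin \o (fun n => (expR (- r) / r) * series (fun k => exp_coeff r k.+1) n)).
    apply/funext => n /=; rewrite /series /= mulr_sumr -sumEFin.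
    apply: eq_bigr => k _; rewrite -EFinM; congr EFin.
    rewrite /poisson_pmf r0 /exp_coeff /= factS natrM exprS.
    have k0 : 1 + k%:R != 0 :> R by rewrite gt_eqF // ltr_wpDr.
    have f0 : k`!%:R != 0 :> R by rewrite pnatr_eq0 -lt0n fact_gt0.
    have rn : r != 0 by rewrite gt_eqF.
    by rewrite -(natr1 k) addrC; field; rewrite f0 rn addrC k0.
  rewrite E; apply: cvg_EFin; first exact: nearW.
  apply: cvgMr; exact: cvg_series_exp_coeff_shift.
rewrite /= mulrBr mulr1 mulrAC -expRD addNr expR0; field.
by rewrite gt_eqF.
Qed.

(** * Analytic inequalities *)

(** After clearing denominators, bounding [expR (t - s)] strictly by its tangent [1 + (t - s)]
    leaves the gap [(s - t) * (1 - (1 + t) * expR (- t))], which is nonnegative because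
    [1 + t <= expR t]. *)
Lemma ltr_div_1BexpRN (R : realType) (s t : R) : 0 < t -> t < s ->
  (1 - expR (- s)) / s < (1 - expR (- t)) / t.
Proof.
move=> t0 ts.
have s0 : 0 < s by exact: lt_trans ts.
rewrite ltr_pdivrMr // mulrAC ltr_pdivlMr //.
have -> : expR (- s) = expR (- t) * expR (t - s) by rewrite -expRD addKr.
have e0 : 0 < expR (- t) by exact: expR_gt0.
have : 1 + (t - s) < expR (t - s) by apply: expR_gt1Dx; rewrite subr_eq0 lt_eqF.
have : (1 + t) * expR (- t) <= 1.
  by rewrite -ler_pdivlMr // expRN invrK mul1r expR_ge1Dx.
move: (expR (- t)) (expR (t - s)) e0 => u v u0 H1 H2.
have H3 : t * u * (1 + (t - s)) < t * u * v by rewrite ltr_pM2l // mulr_gt0.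
have H4 : 0 <= (s - t) * (1 - (1 + t) * u).
  by rewrite mulr_ge0 // subr_ge0 // ltW.
nra.
Qed.

Lemma sum_geometric_grid (R : realType) (m : R) (n : nat) :
  (0 < n)%N -> m * (n%:R^-1 * \sum_(i < n) (1 - m / n%:R) ^+ i)
    = 1 - (1 - m / n%:R) ^+ n.
Proof.
move=> n0.
by rewrite -[RHS]opprB subrX1 mulrA addrAC subrr add0r mulNr opprK.
Qed.

(* The Riemann sums of [t |-> expR (- (m * t))] on [0, 1] exceed the integral
   of [t |-> expR (- (s * t))], which is strictly smaller. *)
Lemma le_grid_sum (R : realType) (s m : R) : 0 < m -> m < s ->
  exists N : nat, forall n, (N <= n)%N ->
    (1 - expR (- s)) / s <= n%:R^-1 * \sum_(i < n) (1 - m / n%:R) ^+ i.+1.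
Proof.
move=> m0 ms; set c : R := (_ / s); pose a : R := (1 - expR (- m)) / m.
have ca : c < a by exact: ltr_div_1BexpRN.
have c0 : 0 < c.
  have s0 : 0 < s by exact: lt_trans ms.
  by rewrite divr_gt0 // subr_gt0 expR_lt1 oppr_lt0.
have a0 : 0 < a by exact: lt_trans ca.
have q0 : 0 <= a * m / (a - c).
  by rewrite ltW //; apply: divr_gt0; [exact: mulr_gt0|rewrite subr_gt0].
(* The grid sum is at least [(1 - m / n) * a], which reaches [c] once [n >= a * m / (a - c)]; the
   summand [m + 1] ensures [0 < n] and [m <= n]. *)
pose N := Num.bound (a * m / (a - c) + m + 1).
have HN : a * m / (a - c) + m + 1 < N%:R by apply: archi_boundP; lra.
exists N => n Nn.
have Hn : a * m / (a - c) + m + 1 < n%:R by apply: lt_le_trans HN _; rewrite ler_nat.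
have n0 : 0 < n%:R :> R by lra.
have mn : m / n%:R <= 1 by rewrite ler_pdivrMr // mul1r; lra.
have -> : n%:R^-1 * (\sum_(i < n) (1 - m / n%:R) ^+ i.+1)
   = (1 - m / n%:R) * ((1 - (1 - m / n%:R) ^+ n) / m).
  rewrite -sum_geometric_grid; last by rewrite -(ltr0n R).
  rewrite -mulrA mulrAC; under eq_bigr do rewrite exprS.
  rewrite -mulr_sumr; field; by rewrite !gt_eqF.
have : (1 - m / n%:R) ^+ n <= expR (- m).
  have -> : - m = n%:R * (- (m / n%:R)) by field; rewrite gt_eqF.
  rewrite expRM_natl; apply: lerXn2r; rewrite ?nnegrE ?subr_ge0 // ?expR_ge0 //.
  exact: expR_ge1Dx.
move=> He.
apply: (@le_trans _ _ ((1 - m / n%:R) * a)); last first.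
  apply: ler_wpM2l; first by rewrite subr_ge0.
  by rewrite ler_pM2r ?invr_gt0 // lerB.
have : a * m <= (a - c) * n%:R.
  have ac : 0 < a - c by rewrite subr_gt0.
  have : a * m / (a - c) * (a - c) <= n%:R * (a - c) by rewrite ler_pM2r //; lra.
  by rewrite divfK ?gt_eqF // mulrC [X in _ <= X]mulrC [X in X <= _]mulrC.
move=> H; have : a * m / n%:R <= a - c by rewrite ler_pdivrMr.
by rewrite mulrBl mul1r [m / _ * a]mulrC mulrA; lra.
Qed.

Lemma prodr_1B_ge (R : realDomainType) (I : finType) (P : pred I) (a : I -> R) :
  (forall i, P i -> 0 <= a i <= 1) ->
  1 - \sum_(i | P i) a i <= \prod_(i | P i) (1 - a i).
Proof.
move=> a01.
(* Strengthened for the induction: multiplying by [1 - a i] also uses the signs of the sum and the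
   product and the bound of the product by 1. *)
suff : (0 <= \sum_(i | P i) a i) && (0 <= \prod_(i | P i) (1 - a i) <= 1) &&
  (1 - \sum_(i | P i) a i <= \prod_(i | P i) (1 - a i)) by case/andP.
elim/big_rec2: _ => [|i p s Pi /andP[/andP[s0 /andP[p0 p1]] ps]].
  by rewrite lexx ler01 lexx subr0 lexx.
have /andP[a0 a1] := a01 _ Pi.
by apply/andP; split; [apply/andP; split; [|apply/andP; split]|]; nra.
Qed.

(** * The race on a finite set with a conflict relation *)

Section Race.
Variables (R : realType) (E : finType) (adj : rel E) (x : E -> R) (n : nat).
Hypothesis x01 : forall e, 0 <= x e <= 1.
Hypothesis n0 : (0 < n)%N.

(* Conditional law of the label of a present edge, so that [x e * arrival_pmf e i]
   is the law of the first success among trials of probability [x e / n]. *)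
Definition arrival_pmf (e : E) (i : nat) : R := n%:R^-1 * (1 - x e / n%:R) ^+ i.

(* The label [n] stands for an arrival time of infinity. *)
Definition label_pmf (A : {set E}) (e : E) (i : 'I_n.+1) : R :=
  if e \in A then
    if (i < n)%N then arrival_pmf e i else 1 - \sum_(j < n) arrival_pmf e j
  else (i == n :> nat)%:R.

(** Ties eliminate both competitors. The guard [g != e] allows [adj] to be reflexive, as [touching]
    is. *)
Definition winners (L : {ffun E -> 'I_n.+1}) : {set E} :=
  [set e | (L e < n)%N && [forall g, (g != e) && adj e g ==> (L e < L g)%N]].

Definition race_pmf (A : {set E}) : {ffun {set E} -> R} :=
  [ffun S => \sum_(L | winners L == S) \prod_e label_pmf A e (L e)].

(* By independence, [\prod_g win_factor e i g (g \in A)] is the probability that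
   [e] wins with label [i < n] when the present edges are those of [A]. *)
Definition win_factor (e : E) (i : nat) (g : E) (present : bool) : R :=
  if g == e then present%:R * arrival_pmf e i
  else if adj e g then 1 - present%:R * \sum_(j < i.+1) arrival_pmf g j
  else 1.

Lemma hazard01 e : 0 <= x e / n%:R <= 1.
Proof.
have /andP[x0 x1] := x01 e.
have n1 : 1 <= n%:R :> R by rewrite ler1n.
apply/andP; split; first exact: divr_ge0.
by rewrite ler_pdivrMr ?ltr0n // mul1r (le_trans x1).
Qed.

Lemma arrival_pmf_ge0 e i : 0 <= arrival_pmf e i.
Proof.
have /andP[_ x1] := hazard01 e.
by rewrite mulr_ge0 // ?invr_ge0 // exprn_ge0 // subr_ge0.
Qed.

Lemma sum_arrival_pmf_le1 e m : (m <= n)%N -> \sum_(j < m) arrival_pmf e j <= 1.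
Proof.
move=> mn; have /andP[x0 x1] := hazard01 e.
apply: (@le_trans _ _ (\sum_(j < m) n%:R^-1)).
  apply: ler_sum => j _; rewrite ler_piMr ?invr_ge0 //.
  by rewrite exprn_ile1 ?subr_ge0 // gerBl.
rewrite sumr_const card_ord -(mulr_natl _ m) ler_pdivrMr ?ltr0n // mul1r.
by rewrite ler_nat.
Qed.

(** Some trial among the first [m] succeeds unless all of them fail; algebraically, a geometric
    sum. *)
Lemma sum_arrival_pmf e m :
  x e * \sum_(j < m) arrival_pmf e j = 1 - (1 - x e / n%:R) ^+ m.
Proof.
rewrite -mulr_sumr -[RHS]opprB subrX1 mulrA.
by rewrite [_ - _ - 1]addrAC subrr add0r mulNr opprK.
Qed.

Lemma label_pmf_ge0 A e i : 0 <= label_pmf A e i.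
Proof.
rewrite /label_pmf; case: ifP => _; last exact: ler0n.
by case: ifP => _; rewrite ?arrival_pmf_ge0 // subr_ge0 sum_arrival_pmf_le1.
Qed.

Lemma sum_label_pmf A e : \sum_i label_pmf A e i = 1.
Proof.
rewrite big_ord_recr /= /label_pmf /= ltnn eqxx.
case: ifP => _.
  by under eq_bigr do rewrite ltn_ord; rewrite addrC subrK.
rewrite big1 ?add0r // => i _.
by rewrite /= (ltn_eqF (ltn_ord i)).
Qed.

Lemma sum_label_pmf_gt A e (i : nat) : (i < n)%N ->
  \sum_(j : 'I_n.+1 | (i < j)%N) label_pmf A e j
    = 1 - (e \in A)%:R * \sum_(j < i.+1) arrival_pmf e j.
Proof.
move=> i_n.
have <- : \sum_(j : 'I_n.+1 | (j < i.+1)%N) label_pmf A e j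
    = (e \in A)%:R * \sum_(j < i.+1) arrival_pmf e j.
  rewrite (big_ord_widen n.+1 (arrival_pmf e)) 1?ltnW // mulr_sumr.
  apply: eq_bigr => j ji; have jn : (j < n)%N by exact: leq_trans ji _.
  by rewrite /label_pmf jn ltn_eqF //; case: (e \in A); rewrite ?mul1r ?mul0r.
rewrite -(sum_label_pmf A e) [in RHS](bigID (fun j : 'I_n.+1 => (j < i.+1)%N)) /=.
rewrite [X in X - _]addrC addrK.
by apply: eq_bigl => j; rewrite ltnNge.
Qed.

Lemma sum_race_pmf A : \sum_S race_pmf A S = 1.
Proof.
under eq_bigr do rewrite ffunE.
transitivity (\sum_(L : {ffun E -> 'I_n.+1}) \prod_e label_pmf A e (L e)).
  by rewrite (partition_big winners xpredT).
rewrite -(bigA_distr_bigA (label_pmf A)) big1 // => e _.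
exact: sum_label_pmf.
Qed.

Lemma race_pmf_ge0 A S : 0 <= race_pmf A S.
Proof.
rewrite ffunE; apply: sumr_ge0 => L _; apply: prodr_ge0 => e _.
exact: label_pmf_ge0.
Qed.

Definition race A : fdist R {set E} := FDist (race_pmf_ge0 A) (sum_race_pmf A).

Lemma race_supp A S : race A S != 0 -> S \subset A.
Proof.
rewrite /= ffunE; apply: contraNT => /subsetPn[e eS eA].
apply/eqP; rewrite big1 // => L /eqP LS.
rewrite (bigD1 e) //= /label_pmf (negbTE eA).
by move: eS; rewrite -LS inE => /andP[/ltn_eqF-> _]; rewrite mul0r.
Qed.

Lemma race_independent A S : race A S != 0 ->
  {in S &, forall e g, adj e g -> adj g e -> e = g}.
Proof.
rewrite /= ffunE => AS.
have [L /eqP<-] : exists L, winners L == S.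
  apply/existsP; apply: contraNT AS; rewrite negb_exists => /forallP LS.
  by rewrite big_pred0 // => L; exact: negbTE.
move=> e g; rewrite !inE => /andP[_ /forallP/(_ g)] + /andP[_ /forallP/(_ e)].
(* Two distinct winners in conflict would each have the strictly smaller label. *)
move=> + + eg ge; rewrite eg ge !andbT; case: eqVneq => //= _.
by move=> /ltn_trans/[apply]; rewrite ltnn.
Qed.

(** Once the label [i] of [e] is fixed, winning is a separate condition [Q g] on each label, so the
    sum over labelings factors into one sum per element. *)
Lemma race_win A e :
  Pr (race A) (fun S => e \in S)
    = \sum_(i < n) \prod_g win_factor e i g (g \in A).
Proof.
rewrite /Pr /=; under eq_bigr do rewrite ffunE.
transitivity (\sum_(L | e \in winners L) \prod_g label_pmf A g (L g)).
  rewrite (partition_big winners (fun S : {set E} => e \in S)) //=.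
  apply: eq_bigr => S eS; apply: eq_bigl => L.
  by case: eqP => [->|]; rewrite ?eS ?andbF.
rewrite (partition_big (fun L : {ffun E -> 'I_n.+1} => L e)
  (fun i : 'I_n.+1 => (i < n)%N)) /=; last by move=> L; rewrite inE => /andP[].
rewrite (big_ord_widen_cond n.+1 xpredT
  (fun i : nat => \prod_g win_factor e i g (g \in A))) //=.
apply: eq_bigr => i i_n.
pose Q g : pred 'I_n.+1 := if g == e then (fun j => j == i) else
   if adj e g then (fun j : 'I_n.+1 => (i < j)%N) else xpredT.
rewrite (eq_bigl (mem (family Q))); last first.
  move=> L; rewrite !inE; apply/idP/familyP.
    move=> /andP[/andP[_ /forallP LQ] /eqP Le] g; have := LQ g.
    rewrite -[_ \in _]/(Q g (L g)) /Q; case: eqVneq => [->|ge] /=; first by rewrite Le eqxx.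
    by case: (adj e g) => //=; rewrite Le.
  move=> LQ; have : Q e (L e) := LQ e; rewrite /Q eqxx => /eqP Le.
  rewrite Le i_n eqxx /= andbT; apply/forallP => g; apply/implyP => /andP[ge eg].
  by have : Q g (L g) := LQ g; rewrite /Q (negbTE ge) eg.
rewrite -(bigA_distr_big_dep Q); apply: eq_bigr => g _; rewrite /Q /win_factor.
case: eqVneq => [->|ge].
  rewrite big_pred1_eq /label_pmf i_n ltn_eqF //.
  by case: (e \in A); rewrite ?mul1r ?mul0r.
case: ifP => _; first exact: sum_label_pmf_gt.
exact: sum_label_pmf.
Qed.

(** The comparison holds factor by factor: the factor of [e] is the same for both sets, and the
    presence of a competitor can only lower its factor. *)
Lemma race_monotone (A B : {set E}) e : e \in A -> A \subset B ->
  Pr (race B) (fun S => e \in S) <= Pr (race A) (fun S => e \in S).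
Proof.
move=> eA AB; rewrite !race_win; apply: ler_sum => i _.
apply: ler_prod => g _; rewrite /win_factor.
case: eqVneq => [->|_].
  by rewrite eA (fintype.subsetP AB _ eA) mul1r arrival_pmf_ge0 lexx.
case: ifP => _; last by rewrite ler01 lexx.
have s0 : 0 <= \sum_(j < i.+1) arrival_pmf g j.
  by apply: sumr_ge0 => j _; exact: arrival_pmf_ge0.
have s1 : \sum_(j < i.+1) arrival_pmf g j <= 1 by exact: sum_arrival_pmf_le1.
have := fintype.subsetP AB g.
by case: (g \in A); case: (g \in B) => [] /implyP; rewrite ?implybT //= => _;
  rewrite ?mul1r ?mul0r; lra.
Qed.

(** Sampling is independent, so the sum over [A] factors as well. A competitor contributes the
    probability that its first [i + 1] trials all fail, whether it is sampled or not. *)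
Lemma sum_sample_win e i :
  \sum_(A : {set E}) (\prod_g bernoulli_pmf (x g) (g \in A)) * \prod_g win_factor e i g (g \in A)
  = \prod_g (if g == e then x e * arrival_pmf e i
             else if adj e g then (1 - x g / n%:R) ^+ i.+1 else 1).
Proof.
transitivity (\prod_g (x g * win_factor e i g true
                       + (1 - x g) * win_factor e i g false)).
  rewrite bigA_distr; apply: eq_bigr => A _.
  rewrite -big_split /=; apply: eq_bigr => g _.
  by rewrite /bernoulli_pmf; case: (g \in A).
apply: eq_bigr => g _; rewrite /win_factor.
case: eqVneq => [->|_]; first by rewrite mul1r mul0r mulr0 addr0.
case: ifP => _; last by rewrite !mulr1 addrC subrK.
by rewrite mul1r mul0r subr0 mulr1 mulrBr mulr1 sum_arrival_pmf; lra.
Qed.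

Lemma selection_prob_race e : adj e e ->
  \sum_(g | adj e g) x g <= n%:R ->
  x e * (n%:R^-1 * \sum_(i < n) (1 - (\sum_(g | adj e g) x g) / n%:R) ^+ i.+1)
    <= \sum_(A : {set E}) (\prod_g bernoulli_pmf (x g) (g \in A))
                        * Pr (race A) (fun S => e \in S).
Proof.
move=> ee xn.
under [leRHS]eq_bigr do rewrite race_win mulr_sumr.
rewrite exchange_big /= mulr_sumr mulr_sumr; apply: ler_sum => i _.
rewrite sum_sample_win.
have /andP[xe0 _] := x01 e.
have h01 g : 0 <= 1 - x g / n%:R <= 1.
  by have /andP[? ?] := hazard01 g; rewrite subr_ge0 gerBl; apply/andP.
(* The product inequality [prodr_1B_ge] is raised to the power [i + 1]; the bound of the total
   weight by [n] keeps the base nonnegative. *)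
apply: (@le_trans _ _ (x e * (n%:R^-1 *
    \prod_(g | adj e g) (1 - x g / n%:R) ^+ i.+1))).
  rewrite ler_wpM2l // ler_wpM2l ?invr_ge0 // prodrXl.
  apply: lerXn2r; rewrite ?nnegrE.
  - by rewrite subr_ge0 ler_pdivrMr ?ltr0n // mul1r.
  - by apply: prodr_ge0 => g _; case/andP: (h01 g).
  - by rewrite mulr_suml; apply: prodr_1B_ge => g _; exact: hazard01.
(* The element [e] is its own neighbour: its factor has exponent [i + 1] on the left but only [i] on
   the right. *)
rewrite (bigD1 e) //= [leRHS](bigD1 e) //= eqxx /arrival_pmf.
rewrite -!mulrA ler_wpM2l // ler_wpM2l ?invr_ge0 //.
rewrite [X in _ * X <= _]big_mkcond [X in _ <= _ * X]big_mkcond /=.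
apply: ler_pM.
- by rewrite exprn_ge0 //; case/andP: (h01 e).
- apply: prodr_ge0 => g _; case: ifP => // _.
  by rewrite exprn_ge0 //; case/andP: (h01 g).
- by rewrite exprS ler_piMl ?exprn_ge0 //; case/andP: (h01 e).
apply: ler_prod => g _; case: eqVneq => //=; case: (adj e g) => //= _;
  rewrite lexx ?ler01 // andbT.
by apply: exprn_ge0; case/andP: (h01 g).
Qed.

End Race.

(** * Degree bounds in the matching polytope *)

Definition touching (G : multigraph) : rel (edge G) :=
  fun e g => ~~ [disjoint ends e & ends g].

(** The constraint set [C] is convex and contains the characteristic vector of every matching, hence
    the whole hull. *)
Lemma polytope_matchings_bounds (R : realType) (G : multigraph) y :
  @polytope R (edge G) (matchings G) y ->
  (forall e, 0 <= y e) /\ (forall v : vertex G, \sum_(e | v \in ends e) y e <= 1).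
Proof.
pose C : set {ffun edge G -> R^o} := [set y | (forall e, 0 <= y e) /\
  (forall v : vertex G, \sum_(e | v \in ends e) y e <= 1)]%classic.
suff : (polytope (matchings G) `<=` C)%classic by apply.
apply: smallest_sub.
  move=> y1 y2 t; rewrite !inE => -[y10 y11] [y20 y21].
  have t0 : 0 <= t%:num by [].
  have t1 : t%:num <= 1 by [].
  have E e : (conv t y1 y2) e = t%:num * y1 e + (1 - t%:num) * y2 e.
    by rewrite /conv /= !ffunE.
  split=> [e|v].
    by rewrite E addr_ge0 // mulr_ge0 // subr_ge0.
  under eq_bigr do rewrite E.
  rewrite big_split /= -!mulr_sumr.
  have := ler_wpM2l t0 (y11 v); have := ler_wpM2l _ (y21 v).
  move=> /(_ (1 - t%:num)); rewrite subr_ge0 => /(_ t1); lra.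
move=> _ [M + <-]; rewrite /= inE => /forallP MM; split=> [e|v].
  by rewrite ffunE ler0n.
under eq_bigr do rewrite ffunE.
have [e /andP[ve eM]|Mv] := pickP (fun e => (v \in ends e) && (e \in M)); last first.
  by rewrite big1 ?ler01 // => e ve; have := Mv e; rewrite /= ve /= => ->.
rewrite (bigD1 e) //= eM big1 ?addr0 // => f /andP[vf fe].
case: (boolP (f \in M)) => // fM.
have /implyP/(_ eM)/forallP/(_ f)/implyP/(_ fM)/implyP := MM e.
rewrite eq_sym => /(_ fe)/disjointFr/(_ ve); by rewrite vf.
Qed.

(** Adding the weights at the two ends of [e] counts every touching edge at least once and [e]
    itself twice. *)
Lemma sum_touching_le (R : realType) (G : multigraph) (y : edge G -> R) (b : R) e :
  (forall e, 0 <= y e) ->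
  (forall v : vertex G, \sum_(e | v \in ends e) y e <= b) ->
  \sum_(g | touching e g) y g <= 2 * b - y e.
Proof.
move=> y0 yb.
have /cards2P[u [v [uv euv]]] : #|ends e| == 2%N by rewrite card_ends.
have : \sum_(g | touching e g) y g + y e
   <= \sum_(g | u \in ends g) y g + \sum_(g | v \in ends g) y g.
  rewrite big_mkcond [X in _ <= X + _]big_mkcond [X in _ <= _ + X]big_mkcond /=.
  rewrite -big_split /= (bigD1 e) //= [leRHS](bigD1 e) //= addrAC.
  apply: lerD.
    rewrite euv !inE !eqxx orbT; case: ifP => _; rewrite ?add0r //.
    by rewrite lerDr.
  apply: ler_sum => g _; case: ifP => [|_]; last first.
    by rewrite addr_ge0 //; case: ifP.
  rewrite /touching -setI_eq0 euv => /set0Pn[w]; rewrite !inE.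
  move=> /andP[/orP[] /eqP-> ->]; first by rewrite lerDl; case: ifP.
  by rewrite lerDr; case: ifP.
by rewrite lerBrDr mulr_natl mulr2n => /le_trans; apply; exact: lerD.
Qed.

(** * Assembly of the scheme *)

(** Membership of [x] is assumed under the existential so that the axiom of choice yields one scheme
    defined for all [x]. *)
Lemma matching_scheme_at (R : realType) (b : R) (G : multigraph)
    (x : {ffun edge G -> R^o}) :
  0 <= b <= 1 ->
  exists pi : {set edge G} -> fdist R {set edge G},
  scaled_polytope b (matchings G) x ->
  [/\ forall A S, pi A S != 0 -> S \subset A /\ S \in matchings G,
      forall e, e \in supp x -> gamma b * x e <=
        \sum_(A : {set edge G}) sample_pmf x A * Pr (pi A) (fun S => e \in S)
    & forall e (A B : {set edge G}), e \in A -> A \subset B ->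
        Pr (pi B) (fun S => e \in S) <= Pr (pi A) (fun S => e \in S)].
Proof.
move=> /andP[b0 b1].
have [|nxP] := pselect (scaled_polytope b (matchings G) x); last first.
  have x001 (e : edge G) : 0 <= (fun=> 0 : R) e <= 1 by rewrite lexx ler01.
  (* Outside the scaled polytope any law will do: here zero weights and a single time slot. *)
  by exists (race (@touching G) x001 (ltn0Sn 0)).
case=> y Py xy.
have [y0 y1] := polytope_matchings_bounds Py.
pose z : edge G -> R := x.
have zE e : z e = b * y e by rewrite /z -xy ffunE.
have z0 e : 0 <= z e by rewrite zE mulr_ge0.
have zb (v : vertex G) : \sum_(e | v \in ends e) z e <= b.
  under eq_bigr do rewrite zE.
  by rewrite -mulr_sumr ler_piMr.
have zeb e : z e <= b.
  have [v ve] : exists v, v \in ends e.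
    by apply/set0Pn; rewrite -card_gt0 card_ends.
  apply: le_trans (zb v); rewrite (bigD1 e) //= lerDl.
  by apply: sumr_ge0 => g _.
have z01 e : 0 <= z e <= 1 by rewrite z0 (le_trans (zeb e)).
(* A positive [z e] forces [0 < b], so the closed form of [gamma] applies, and makes [2 * b - z e]
   strictly smaller than [2 * b], as the grid bound requires. *)
have /fin_all_exists[N HN] : forall e, exists N : nat, 0 < z e ->
    forall n, (N <= n)%N -> gamma b <=
      n%:R^-1 * \sum_(i < n) (1 - (2 * b - z e) / n%:R) ^+ i.+1.
  move=> e; have [ze|] := ltP 0 (z e); last by exists 0%N.
  have be := zeb e; have bp : 0 < b by exact: lt_le_trans be.
  have m0 : 0 < 2 * b - z e by lra.
  have ms : 2 * b - z e < 2 * b by lra.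
  have [N HN] := le_grid_sum m0 ms.
  by exists N => _; rewrite gammaE.
(* The sum dominates every threshold [N e]; the 2 gives [2 * b <= n], which keeps the bases
   [1 - l / n] nonnegative. *)
pose n := (\sum_e N e + 2)%N.
have n0 : (0 < n)%N by rewrite /n addn2.
have n2 : 2 <= n%:R :> R by rewrite ler_nat /n leq_addl.
exists (race (@touching G) z01 n0) => _; split.
- move=> A S AS; split; first exact: race_supp AS.
  rewrite inE; apply/forallP => e; apply/implyP => eS.
  apply/forallP => f; apply/implyP => fS; apply/implyP.
  apply: contraNT => ef; apply/eqP.
  by apply: (race_independent AS); rewrite // /touching disjoint_sym.
- move=> e; rewrite inE => xe0.
  have ze : 0 < z e by rewrite lt_neqAle eq_sym xe0 z0.
  have se := sum_touching_le e z0 zb.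
  have ee : touching e e.
    by rewrite /touching -setI_eq0 finset.setIid -card_gt0 card_ends.
  have Ne : (N e <= n)%N by rewrite /n (bigD1 e) //= -addnA leq_addr.
  apply: le_trans (selection_prob_race z01 n0 ee _); last by lra.
  (* Replacing the touching weight by its upper bound [2 * b - z e] lowers each term of the grid
     sum. *)
  rewrite mulrC ler_pM2l //; apply: (le_trans (HN e ze n Ne)).
  rewrite ler_wpM2l ?invr_ge0 //; apply: ler_sum => i _.
  apply: lerXn2r; rewrite ?nnegrE.
  + by rewrite subr_ge0 ler_pdivrMr ?ltr0n // mul1r; lra.
  + by rewrite subr_ge0 ler_pdivrMr ?ltr0n // mul1r; lra.
  + by rewrite lerB // ler_pM2r ?invr_gt0 ?ltr0n.
- by move=> e A B; exact: race_monotone.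
Qed.

Theorem theorem8 (R : realType) (b : R) (hb : 0 <= b <= 1) (G : multigraph) :
  exists pi : random_selection R (edge G),
    balanced_cr_scheme (matchings G) b (gamma b) pi /\
    monotone_scheme (matchings G) b pi.
Proof.
have /choice[pi piP] := fun x => @matching_scheme_at R b G x hb.
exists pi; split=> [x xP|x xP e A B eA AB _]; have [H1 H2 H3] := piP x xP.
  by split=> [A _ S|]; [exact: H1|exact: H2].
exact: H3.
Qed.
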